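(* Let $d\ge1$ be an integer, $0\le\lambda\le1$, and let $\mathcal{D}_{d,\lambda}$ be the partially depolarizing channel on $\mathbb{C}^d$, $\mathcal{D}_{d,\lambda}(\rho)=\lambda\rho+(1-\lambda)\mathrm{Tr}(\rho)\frac{\mathbb{I}}{d}$. Then $$\mathrm{cv}(\mathcal{D}_{d,\lambda})=\lambda d+(1-\lambda)\quad\text{and}\quad\mathcal{CV}(\mathcal{D}_{d,\lambda})=\log_2\mathrm{cv}(\mathcal{D}_{d,\lambda}),$$ where $\mathcal{CV}(\mathcal{N})=\lim_{k\to\infty}\frac1k\log_2\mathrm{cv}(\mathcal{N}^{\otimes k})$ is the cv capacity.
   Context: Communication value: for a classical channel with transition probabilities $P(y|x)$, $x\in[n]$, $y\in[n']$, put $\mathrm{cv}(\mathbf{P})=\sum_{y\in[n']}\max_{x\in[n]}P(y|x)$. For a quantum channel (CPTP map) $\mathcal{N}$, $\mathrm{cv}(\mathcal{N})$ is the supremum, over all $n,n'\in\mathbb{N}$, all density operators $\rho_1,\dots,\rho_n$ on the input space and all POVMs $\{\Pi_y\}_{y=1}^{n'}$ on the output space, of $\mathrm{cv}(\mathbf{P})$ with $P(y|x)=\mathrm{Tr}[\Pi_y\mathcal{N}(\rho_x)]$. *)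

(* Defs.v *)
From HB Require Import structures.
From mathcomp Require Import all_boot all_order all_algebra.
From mathcomp Require Import ring complex mxtens.
From mathcomp Require Import all_classical all_reals all_analysis.

Set Implicit Arguments.
Unset Strict Implicit.
Unset Printing Implicit Defensive.

Import Order.TTheory GRing.Theory Num.Theory.
Import numFieldNormedType.Exports.

Local Open Scope classical_set_scope.
Local Open Scope ring_scope.
Local Open Scope sesquilinear_scope.
Local Open Scope complex_scope.

Section States.
Variable R : realType.
Local Notation C := R[i].

(* In R[i], 0 <= z means that z is real and nonnegative, so psdmx A forces A to be
   Hermitian. *)
Definition psdmx n (A : 'M[C]_n) : Prop :=
  forall v : 'cV[C]_n, 0 <= (v ^t* *m A *m v) 0 0.

Definition density n (rho : 'M[C]_n) : Prop := psdmx rho /\ \tr rho = 1.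

Definition povm n k (Pi : 'I_k -> 'M[C]_n) : Prop :=
  (forall y, psdmx (Pi y)) /\ \sum_(y < k) Pi y = 1%:M.

End States.

Section TensorMap.
Variable R : realType.
Local Notation C := R[i].
Variables (m n p q : nat).
Variables (f : {linear 'M[C]_m -> 'M[C]_n}) (g : {linear 'M[C]_p -> 'M[C]_q}).

(* The linear map f (x) g, given by its values on the matrix units
   E_ab = E_(a.1, b.1) (x) E_(a.2, b.2); see tensmap_tens. *)
Definition tensmap (X : 'M[C]_(m * p)) : 'M[C]_(n * q) :=
  \sum_(a < m * p) \sum_(b < m * p)
    X a b *: (f (delta_mx (mxtens_unindex a).1 (mxtens_unindex b).1) *t
              g (delta_mx (mxtens_unindex a).2 (mxtens_unindex b).2)).

Fact tensmap_is_linear : linear tensmap.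
Proof.
move=> c X Y; rewrite /tensmap scaler_sumr -big_split /=; apply: eq_bigr => a _.
rewrite scaler_sumr -big_split /=; apply: eq_bigr => b _.
by rewrite !mxE scalerDl scalerA.
Qed.

HB.instance Definition _ :=
  GRing.isLinear.Build C 'M[C]_(m * p) 'M[C]_(n * q) _ tensmap tensmap_is_linear.

End TensorMap.

Section Channels.
Variable R : realType.
Local Notation C := R[i].

Definition completely_positive m n (f : {linear 'M[C]_m -> 'M[C]_n}) : Prop :=
  forall (k : nat) (X : 'M[C]_(k * m)),
    psdmx X -> psdmx (tensmap (idfun : {linear 'M[C]_k -> 'M[C]_k}) f X).

Definition trace_preserving m n (f : {linear 'M[C]_m -> 'M[C]_n}) : Prop :=
  forall X, \tr (f X) = \tr X.

Record channel m n := Channel {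
  channel_map :> {linear 'M[C]_m -> 'M[C]_n};
  channel_cp : completely_positive channel_map;
  channel_tp : trace_preserving channel_map }.

End Channels.

Arguments channel : clear implicits.


Section ChannelFacts.
Variable R : realType.
Local Notation C := R[i].

Definition psdker (I : finType) (A : I -> I -> C) : Prop :=
  forall v : I -> C, 0 <= \sum_a \sum_b (v a)^* * A a b * v b.

Lemma psdmxP n (A : 'M[C]_n) : psdmx A <-> psdker (fun i j => A i j).
Proof.
have E (v : 'I_n -> C) : ((\col_i v i) ^t* *m A *m (\col_i v i)) 0 0 =
    \sum_a \sum_b (v a)^* * A a b * v b.
  rewrite mxE exchange_big /=; apply: eq_bigr => j _.
  rewrite !mxE mulr_suml; apply: eq_bigr => i _.
  by rewrite !mxE.
split=> H v; first by rewrite -E.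
by have := H (fun i => v i 0); rewrite -E; congr (0 <= (_ ^t* *m _ *m _) _ _);
  apply/matrixP => i j; rewrite !mxE ord1.
Qed.

Lemma eq_psdker (I : finType) (A B : I -> I -> C) :
  (forall a b, A a b = B a b) -> psdker A -> psdker B.
Proof.
move=> AB H v; have := H v; congr (0 <= _).
by apply: eq_bigr => a _; apply: eq_bigr => b _; rewrite AB.
Qed.

Lemma psdker_bij (I J : finType) (h : J -> I) (A : I -> I -> C) :
  bijective h -> psdker A -> psdker (fun a b => A (h a) (h b)).
Proof.
move=> [h' hK h'K] H v; have := H (v \o h'); congr (0 <= _).
rewrite (reindex h) /=; last by exists h' => x _; [exact: hK|exact: h'K].
apply: eq_bigr => a _.
rewrite (reindex h) /=; last by exists h' => x _; [exact: hK|exact: h'K].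
by apply: eq_bigr => b _; rewrite !hK.
Qed.

Lemma sum_mxtens (V : nmodType) m p (F : 'I_(m * p) -> V) :
  \sum_a F a = \sum_i \sum_k F (mxtens_index (i, k)).
Proof.
rewrite pair_big /= (reindex (@mxtens_index m p)) /=.
  by apply: eq_bigr => -[].
by exists (@mxtens_unindex m p) => x _; rewrite ?mxtens_indexK ?mxtens_unindexK.
Qed.

Lemma lin_entry m n (f : {linear 'M[C]_m -> 'M[C]_n}) M i j :
  f M i j = \sum_s \sum_t M s t * f (delta_mx s t) i j.
Proof.
rewrite [in LHS](matrix_sum_delta M) linear_sum summxE; apply: eq_bigr => s _.
rewrite linear_sum summxE; apply: eq_bigr => t _.
by rewrite linearZ mxE.
Qed.

Lemma tensmapE m n p q (f : {linear 'M[C]_m -> 'M[C]_n})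
    (g : {linear 'M[C]_p -> 'M[C]_q}) (X : 'M[C]_(m * p)) i j k l :
  tensmap f g X (mxtens_index (i, k)) (mxtens_index (j, l)) =
  f (\matrix_(s, t)
       g (\matrix_(u, w) X (mxtens_index (s, u)) (mxtens_index (t, w))) k l) i j.
Proof.
rewrite /tensmap sum_mxtens summxE lin_entry; apply: eq_bigr => s _.
transitivity (\sum_u \sum_t \sum_w X (mxtens_index (s, u)) (mxtens_index (t, w))
    * (f (delta_mx s t) i j * g (delta_mx u w) k l)).
  rewrite summxE; apply: eq_bigr => u _; rewrite sum_mxtens summxE.
  apply: eq_bigr => t _; rewrite summxE; apply: eq_bigr => w _.
  by rewrite mxE !mxtens_indexK tensmxE.
rewrite exchange_big; apply: eq_bigr => t _ /=.
rewrite mxE [X in _ = X * _]lin_entry mulr_suml; apply: eq_bigr => u _.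
rewrite mulr_suml; apply: eq_bigr => w _.
by rewrite mxE -mulrA [f _ _ _ * _]mulrC.
Qed.

Lemma tensmap_tens m n p q (f : {linear 'M[C]_m -> 'M[C]_n})
    (g : {linear 'M[C]_p -> 'M[C]_q}) (A : 'M[C]_m) (B : 'M[C]_p) :
  tensmap f g (A *t B) = f A *t g B.
Proof.
apply/matrixP => a b.
case: (mxtens_indexP a) => i k; case: (mxtens_indexP b) => j l.
rewrite tensmapE tensmxE mulrC.
rewrite (_ : (\matrix_(s, t) _) = g B k l *: A); first by rewrite linearZ mxE.
apply/matrixP => s t; rewrite !mxE mulrC.
rewrite (_ : (\matrix_(u, w) _) = A s t *: B); first by rewrite linearZ mxE.
by apply/matrixP => u w; rewrite mxE tensmxE mxE.
Qed.

Lemma tensmap_idE k m n (f : {linear 'M[C]_m -> 'M[C]_n}) (X : 'M[C]_(k * m))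
    (a b : 'I_k * 'I_n) :
  tensmap idfun f X (mxtens_index a) (mxtens_index b) =
  f (\matrix_(s, t) X (mxtens_index (a.1, s)) (mxtens_index (b.1, t))) a.2 b.2.
Proof. by case: a b => [a i] [b j]; rewrite tensmapE /= mxE. Qed.

Lemma mxtens_index_bij m n : bijective (@mxtens_index m n).
Proof.
by exists (@mxtens_unindex m n); [exact: mxtens_indexK|exact: mxtens_unindexK].
Qed.

Lemma mxtens_unindex_bij m n : bijective (@mxtens_unindex m n).
Proof.
by exists (@mxtens_index m n); [exact: mxtens_unindexK|exact: mxtens_indexK].
Qed.

Lemma psdker_tens m n (X : 'M[C]_(m * n)) :
  psdmx X <-> psdker (fun a b => X (mxtens_index a) (mxtens_index b)).
Proof.
rewrite psdmxP; split=> [/psdker_bij|] H.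
  exact: H (mxtens_index_bij m n).
apply: eq_psdker (psdker_bij (mxtens_unindex_bij m n) H) => a b.
by rewrite !mxtens_unindexK.
Qed.

Lemma cp_kernel m n (f : {linear 'M[C]_m -> 'M[C]_n}) (K : finType)
    (A : K * 'I_m -> K * 'I_m -> C) : completely_positive f -> psdker A ->
  psdker (fun a b : K * 'I_n =>
    f (\matrix_(i, j) A (a.1, i) (b.1, j)) a.2 b.2).
Proof.
move=> fcp Apsd.
pose h r (a : 'I_#|K| * 'I_r) := (enum_val a.1, a.2).
pose h' r (a : K * 'I_r) := (enum_rank a.1, a.2).
have hK r : cancel (@h r) (@h' r) by case=> a i; rewrite /h/h' /= enum_valK.
have h'K r : cancel (@h' r) (@h r) by case=> a i; rewrite /h/h' /= enum_rankK.
pose X : 'M[C]_(#|K| * m) :=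
  \matrix_(a, b) A (h _ (mxtens_unindex a)) (h _ (mxtens_unindex b)).
have /fcp/psdker_tens/(psdker_bij (Bijective (h'K n) (hK n))) : psdmx X.
  apply/psdker_tens; apply: eq_psdker (psdker_bij (Bijective (hK m) (h'K m)) Apsd).
  by move=> a b; rewrite mxE !mxtens_indexK.
apply: eq_psdker => a b; rewrite tensmap_idE /=; congr (f _ _ _).
apply/matrixP => s t; rewrite !mxE.
have E (c : K) u : h m (mxtens_unindex (mxtens_index (enum_rank c, u))) = (c, u).
  by rewrite -[RHS](h'K m); congr h; exact: mxtens_indexK.
by rewrite !E.
Qed.

Lemma tensmap_cp m n p q (f : {linear 'M[C]_m -> 'M[C]_n})
    (g : {linear 'M[C]_p -> 'M[C]_q}) :
  completely_positive f -> completely_positive g ->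
  completely_positive (tensmap f g).
Proof.
move=> fcp gcp k X /psdker_tens Xpsd; apply/psdker_tens.
pose h (a : ('I_k * 'I_m) * 'I_p) := (a.1.1, mxtens_index (a.1.2, a.2)).
have hb : bijective h.
  exists (fun b : 'I_k * 'I_(m * p) =>
      ((b.1, (mxtens_unindex b.2).1), (mxtens_unindex b.2).2)).
    by move=> [[a i] u]; rewrite /h [X in mxtens_unindex X]/= mxtens_indexK.
  by move=> [a c]; case: (mxtens_indexP c) => i u; rewrite mxtens_indexK.
have /(cp_kernel gcp) H1 := psdker_bij hb Xpsd.
pose sw r s (a : ('I_k * 'I_r) * 'I_s) := ((a.1.1, a.2), a.1.2).
have swb r s : bijective (@sw r s).
  by exists (@sw s r) => -[[? ?] ?].
have /(cp_kernel fcp) H2 := psdker_bij (swb q m) H1.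
pose h2 (b : 'I_k * 'I_(n * q)) :=
  ((b.1, (mxtens_unindex b.2).2), (mxtens_unindex b.2).1).
have h2b : bijective h2.
  exists (fun a => (a.1.1, mxtens_index (a.2, a.1.2))).
    by move=> [a c]; case: (mxtens_indexP c) => i u; rewrite /h2 mxtens_indexK.
  by move=> [[a i] u]; rewrite /h2 mxtens_indexK.
apply: eq_psdker (psdker_bij h2b H2) => -[a c] [b e].
case: (mxtens_indexP c) => i u; case: (mxtens_indexP e) => j w.
rewrite tensmap_idE tensmapE.
have E x y z : h2 (x, mxtens_index (y, z)) = ((x, z), y).
  by rewrite /h2 mxtens_indexK.
rewrite !E; congr (f _ _ _).
apply/matrixP => s t; rewrite !mxE /=; congr (g _ _ _).
by apply/matrixP => y z; rewrite !mxE.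
Qed.

Lemma mxtrace_tens m n (A : 'M[C]_m) (B : 'M[C]_n) :
  \tr (A *t B) = \tr A * \tr B.
Proof.
rewrite /mxtrace sum_mxtens mulr_suml; apply: eq_bigr => i _.
by rewrite mulr_sumr; apply: eq_bigr => j _; rewrite tensmxE.
Qed.

Lemma mxtrace_delta m (i j : 'I_m) : \tr (delta_mx i j : 'M[C]_m) = (i == j)%:R.
Proof.
rewrite /mxtrace (bigD1 i) //= mxE eqxx /= big1 ?addr0 // => k /negbTE ki.
by rewrite mxE ki.
Qed.

Lemma tensmap_tp m n p q (f : {linear 'M[C]_m -> 'M[C]_n})
    (g : {linear 'M[C]_p -> 'M[C]_q}) :
  trace_preserving f -> trace_preserving g -> trace_preserving (tensmap f g).
Proof.
move=> ftp gtp X; rewrite /tensmap raddf_sum; apply: eq_bigr => a _ /=.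
rewrite raddf_sum (bigD1 a) //= big1 => [|b ba].
  by rewrite mxtraceZ mxtrace_tens ftp gtp !mxtrace_delta !eqxx !mulr1 addr0.
rewrite mxtraceZ mxtrace_tens ftp gtp !mxtrace_delta -natrM mulnb.
case: eqP => [E1|]; case: eqP => [E2|] /=; rewrite ?mulr0 //.
case/eqP: ba; rewrite -[a]mxtens_unindexK -[b]mxtens_unindexK.
by congr mxtens_index; apply/esym/eqP; rewrite -pair_eqE /= /pair_eq E1 E2 !eqxx.
Qed.

Lemma idfun_cp n : completely_positive (idfun : {linear 'M[C]_n -> 'M[C]_n}).
Proof.
move=> k X /psdker_tens H; apply/psdker_tens; apply: eq_psdker H => -[a i] [b j].
by rewrite tensmap_idE /= mxE.
Qed.

Lemma idfun_tp n : trace_preserving (idfun : {linear 'M[C]_n -> 'M[C]_n}).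
Proof. by []. Qed.

End ChannelFacts.

Section ChannelPowers.
Variable R : realType.

Definition idchannel n : channel R n n := Channel (@idfun_cp R n) (@idfun_tp R n).

Definition tenschannel m n p q (N : channel R m n) (M : channel R p q) :
    channel R (m * p) (n * q) :=
  Channel (tensmap_cp (channel_cp N) (channel_cp M))
          (tensmap_tp (channel_tp N) (channel_tp M)).

Fixpoint channel_pow_rec m n (N : channel R m n) k :
    channel R (m ^ k.+1) (n ^ k.+1) :=
  if k is k'.+1 then tenschannel N (channel_pow_rec N k') else N.

(* N^{(x) k}. The split between k = 0 and k = k'.+1 follows ntensmx: m ^ k.+2 is
   convertible to m * m ^ k.+1, but m ^ 1 is m rather than m * m ^ 0. *)
Definition channel_pow m n (N : channel R m n) k : channel R (m ^ k) (n ^ k) :=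
  if k is k'.+1 return channel R (m ^ k) (n ^ k)
  then channel_pow_rec N k' else idchannel 1.

End ChannelPowers.

Section Depolarizing.
Variables (R : realType) (d : nat) (lambda : R).
Local Notation C := R[i].

Definition depolmx (rho : 'M[C]_d) : 'M[C]_d :=
  lambda%:C *: rho + ((1 - lambda)%:C * \tr rho) *: (d%:R^-1 *: 1%:M).

Fact depolmx_is_linear : linear depolmx.
Proof.
move=> c X Y; rewrite /depolmx mxtraceD mxtraceZ mulrDr !scalerDr scalerDl.
rewrite mulrCA -[(c * _) *: _]scalerA addrACA; congr (_ + _ + _).
by rewrite !scalerA mulrC.
Qed.

HB.instance Definition _ :=
  GRing.isLinear.Build C 'M[C]_d 'M[C]_d _ depolmx depolmx_is_linear.

Hypotheses (d_gt0 : (0 < d)%N) (lambda01 : 0 <= lambda <= 1).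

Lemma depolmx_tp : trace_preserving depolmx.
Proof.
move=> X; rewrite /depolmx linearD /= !mxtraceZ mxtrace1.
rewrite mulVf ?mulr1 ?pnatr_eq0 -?lt0n // -mulrDl -rmorphD /=.
by rewrite addrC subrK mul1r.
Qed.

Lemma depolmx_cp : completely_positive depolmx.
Proof.
case/andP: lambda01 => l0 l1 k X /psdker_tens Xpsd; apply/psdker_tens => v.
pose Y (a b : 'I_k * 'I_d) := X (mxtens_index a) (mxtens_index b).
pose c : C := (1 - lambda)%:C * d%:R^-1.
pose w i s (a : 'I_k * 'I_d) : C := v (a.1, i) *+ (a.2 == s).
have E : \sum_a \sum_b (v a)^* *
      tensmap idfun depolmx X (mxtens_index a) (mxtens_index b) * v b =
    lambda%:C * (\sum_a \sum_b (v a)^* * Y a b * v b) +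
    c * \sum_i \sum_s \sum_a \sum_b (w i s a)^* * Y a b * w i s b.
  have -> : \sum_i \sum_s \sum_a \sum_b (w i s a)^* * Y a b * w i s b =
    \sum_(a : 'I_k * 'I_d) \sum_(b : 'I_k * 'I_d)
      (v a)^* * ((a.2 == b.2)%:R * \sum_s Y (a.1, s) (b.1, s)) * v b.
    have S (F : 'I_k * 'I_d -> C) s :
        (forall a, a.2 != s -> F a = 0) -> \sum_a F a = \sum_x F (x, s).
      move=> F0; rewrite (eq_bigr (fun a => F (a.1, a.2))); last by case.
      rewrite -(pair_big xpredT xpredT (fun x y => F (x, y))) /=.
      apply: eq_bigr => x _; rewrite (bigD1 s) //= big1 ?addr0 // => y ys.
      exact: F0.
    transitivity (\sum_i \sum_s \sum_x \sum_y
        (v (x, i))^* * Y (x, s) (y, s) * v (y, i)).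
      apply: eq_bigr => i _; apply: eq_bigr => s _.
      rewrite (S _ s) => [|a as_]; last first.
        by rewrite big1 // => b _; rewrite /w (negbTE as_) mulr0n conjC0 !mul0r.
      apply: eq_bigr => x _.
      rewrite (S _ s) => [|a as_]; last by rewrite {2}/w (negbTE as_) mulr0n mulr0.
      by apply: eq_bigr => y _; rewrite /w /= !eqxx !mulr1n.
    rewrite [RHS](eq_bigr (fun a => \sum_(b : 'I_k * 'I_d)
      (v (a.1, a.2))^* * ((a.2 == b.2)%:R * \sum_s Y (a.1, s) (b.1, s)) * v b));
      last by case.
    rewrite -(pair_big xpredT xpredT (fun x i => \sum_(b : 'I_k * 'I_d)
      (v (x, i))^* * ((i == b.2)%:R * \sum_s Y (x, s) (b.1, s)) * v b)) /=.
    rewrite [RHS]exchange_big /=; apply: eq_bigr => i _.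
    rewrite exchange_big /=; apply: eq_bigr => x _.
    rewrite (S _ i) => [|b /negbTE bi]; last by rewrite eq_sym bi mul0r mulr0 mul0r.
    rewrite exchange_big /=; apply: eq_bigr => y _.
    by rewrite eqxx mul1r mulr_sumr mulr_suml.
  rewrite !mulr_sumr -big_split /=; apply: eq_bigr => a _.
  rewrite !mulr_sumr -big_split /=; apply: eq_bigr => b _.
  rewrite tensmap_idE /depolmx !mxE /mxtrace.
  have -> : \sum_i (\matrix_(s, t) X (mxtens_index (a.1, s))
      (mxtens_index (b.1, t))) i i = \sum_s Y (a.1, s) (b.1, s).
    by apply: eq_bigr => s _; rewrite mxE.
  rewrite /c -!surjective_pairing -/(Y a b).
  set e := d%:R^-1; set t := (_ == _)%:R; set y := \sum_s _.
  by move: e t y => e t y; ring.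
rewrite E; apply: addr_ge0; apply: mulr_ge0.
- by rewrite lecR.
- exact: Xpsd.
- by rewrite mulr_ge0 ?invr_ge0 ?ler0n // lecR subr_ge0.
- by apply: sumr_ge0 => i _; apply: sumr_ge0 => s _; exact: Xpsd.
Qed.

Definition depolarizing : channel R d d := Channel depolmx_cp depolmx_tp.

End Depolarizing.

Section CommunicationValue.
Variable R : realType.
Local Notation C := R[i].

(* P y x is P(y|x); entries are nonnegative, so the default 0 of the maximum only
   matters when there are no inputs. *)
Definition classical_cv n n' (P : 'I_n' -> 'I_n -> R) : R :=
  \sum_(y < n') \big[Num.max/0]_(x < n) P y x.

(* The trace is real when rho x is a density and Pi a POVM; complex.Re only
   changes the type. *)
Definition transition m k (N : channel R m k) n n'
    (rho : 'I_n -> 'M[C]_m) (Pi : 'I_n' -> 'M[C]_k) : 'I_n' -> 'I_n -> R :=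
  fun y x => complex.Re (\tr (Pi y *m N (rho x))).

Definition cv_values m k (N : channel R m k) : set R :=
  [set c | exists (n n' : nat) (rho : 'I_n -> 'M[C]_m) (Pi : 'I_n' -> 'M[C]_k),
     [/\ (0 < n)%N, (forall x, density (rho x)), povm Pi &
         c = classical_cv (transition N rho Pi)]].

(* cv_values N is bounded by the output dimension k, and nonempty when m > 0, so
   the supremum in R is the true one. *)
Definition cv m k (N : channel R m k) : R := sup (cv_values N).

Definition log2 (x : R) : R := ln x / ln 2.

(* At k = 0 the value is 0 by the convention 0^-1 = 0. *)
Definition cv_rate m n (N : channel R m n) (k : nat) : R :=
  k%:R^-1 * log2 (cv (channel_pow N k)).

Definition cv_capacity m n (N : channel R m n) : R := limn (cv_rate N).

End CommunicationValue.

(* Main.v *)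
(* Writing D^{(x)k} = sum_S lambda^|S| (1 - lambda)^(k - |S|) (id_S (x) depolarizing)
   and rho_S <= I for every marginal of a state rho, one gets
   D^{(x)k}(rho) <= (lambda + (1 - lambda)/d)^k I, even for entangled rho; pairing with
   a POVM bounds the communication value by (lambda d + 1 - lambda)^k.  The
   computational basis, sent and measured, attains this value.  The induction on k
   needs the operator inequality in the presence of an arbitrary ancilla. *)

Require Import Defs.
From mathcomp Require Import all_boot all_order all_algebra.
From mathcomp Require Import ring lra complex mxtens.
From mathcomp Require Import all_classical all_reals all_analysis.

Set Implicit Arguments.
Unset Strict Implicit.
Unset Printing Implicit Defensive.

Import Order.TTheory GRing.Theory Num.Theory.
Import numFieldNormedType.Exports.

Local Open Scope classical_set_scope.
Local Open Scope ring_scope.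

(** * Closure properties of positive semidefinite kernels *)

Section PositiveKernels.
Variable R : realType.
Local Notation C := R[i].
Implicit Types I J : finType.

(** The form of the pulled-back kernel at [v] is the form of [A] at the sums of [v] over the fibres
    of [h]. Injectivity is not assumed, so this covers relabellings, restrictions and repeated
    indices alike. *)
Lemma psdker_comp I J (h : J -> I) (A : I -> I -> C) :
  psdker A -> psdker (fun a b => A (h a) (h b)).
Proof.
move=> Apsd v; have := Apsd (fun i => \sum_(j | h j == i) v j).
congr (0 <= _); rewrite [RHS](partition_big h xpredT) //=.
apply: eq_bigr => i _.
under [RHS]eq_bigr do rewrite (partition_big h xpredT) //=.
rewrite exchange_big /=; apply: eq_bigr => j _.
rewrite rmorph_sum /= !mulr_suml; apply: eq_bigr => a /eqP ->.
by rewrite mulr_sumr; apply: eq_bigr => b /eqP ->.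
Qed.

Lemma psdkerD I (A B : I -> I -> C) :
  psdker A -> psdker B -> psdker (fun a b => A a b + B a b).
Proof.
move=> Apsd Bpsd v; have := addr_ge0 (Apsd v) (Bpsd v); congr (0 <= _).
rewrite -big_split /=; apply: eq_bigr => a _; rewrite -big_split /=.
by apply: eq_bigr => b _; rewrite mulrDr mulrDl.
Qed.

Lemma psdkerZ I (c : C) (A : I -> I -> C) :
  0 <= c -> psdker A -> psdker (fun a b => c * A a b).
Proof.
move=> c0 Apsd v; have := mulr_ge0 c0 (Apsd v); congr (0 <= _).
rewrite mulr_sumr; apply: eq_bigr => a _; rewrite mulr_sumr.
by apply: eq_bigr => b _; rewrite !mulrA [c * _]mulrC.
Qed.

Lemma psdker_sum I J (A : J -> I -> I -> C) :
  (forall s, psdker (A s)) -> psdker (fun a b => \sum_s A s a b).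
Proof.
move=> Apsd v; have : 0 <= \sum_s \sum_a \sum_b (v a)^* * A s a b * v b.
  by apply: sumr_ge0 => s _; exact: Apsd.
congr (0 <= _); rewrite exchange_big; apply: eq_bigr => a _.
rewrite exchange_big; apply: eq_bigr => b _.
by rewrite mulr_sumr mulr_suml.
Qed.

Lemma psdker_ptrace I J (A : I * J -> I * J -> C) :
  psdker A -> psdker (fun a b => \sum_s A (a, s) (b, s)).
Proof.
move=> Apsd; apply: psdker_sum => s.
exact: (psdker_comp (fun a : I => (a, s) : (I * J)%type) Apsd).
Qed.

(** This is A (x) I: its form at [v] is the sum over [s] of the forms of [A] at the slices
    [v (_, s)]. *)
Lemma psdker_tens1 I J (A : I -> I -> C) : psdker A ->
  psdker (fun a b : I * J => A a.1 b.1 * (a.2 == b.2)%:R).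
Proof.
move=> Apsd v.
have : 0 <= \sum_s \sum_a \sum_b (v (a, s))^* * A a b * v (b, s).
  by apply: sumr_ge0 => s _; exact: Apsd.
congr (0 <= _); rewrite exchange_big pair_big; apply: eq_bigr => -[a s] _.
rewrite (eq_bigr (fun b => (v (a, s))^* * (A a b.1 * (s == b.2)%:R) *
  v (b.1, b.2))); last by case.
rewrite -(pair_big xpredT xpredT (fun b t => (v (a, s))^* *
  (A a b * (s == t)%:R) * v (b, t))) /=.
apply: eq_bigr => b _; rewrite (bigD1 s) //= eqxx mulr1 big1 ?addr0 // => t.
by rewrite eq_sym => /negbTE ->; rewrite mulr0 mulr0 mul0r.
Qed.

Lemma psdker_pair I (A : I -> I -> C) (a b : I) (x y : C) : psdker A ->
  0 <= x^* * A a a * x + x^* * A a b * y +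
       (y^* * A b a * x + y^* * A b b * y).
Proof.
move=> Apsd; pose h (c : bool) := if c then a else b.
by have := psdker_comp h Apsd (fun c => if c then x else y);
  rewrite !big_bool.
Qed.

Lemma psdker_diag_ge0 I (A : I -> I -> C) (a : I) : psdker A -> 0 <= A a a.
Proof.
by move=> /(psdker_pair a a 1 0); rewrite conjC0 conjC1
  !(mul0r, mulr0, mul1r, mulr1, addr0).
Qed.

(** Polarization: the forms at e_a + e_b and e_a + i e_b have zero imaginary part, as do the
    diagonal entries, and this determines [A b a] from [A a b]. *)
Lemma psdker_herm I (A : I -> I -> C) (a b : I) : psdker A ->
  A b a = (A a b)^*.
Proof.
move=> Apsd.
have := psdker_pair a b 1 1 Apsd; have := psdker_pair a b 1 'i%C Apsd.
have := psdker_diag_ge0 a Apsd; have := psdker_diag_ge0 b Apsd.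
case: (A a a) (A b b) (A a b) (A b a) => [p p'] [q q'] [s s'] [t t'].
rewrite !lecE /= => /andP[/eqP q0 _] /andP[/eqP p0 _] /andP[/eqP e1 _].
move=> /andP[/eqP e2 _]; apply/eqP; rewrite eq_complex /=.
by apply/andP; split; apply/eqP; lra.
Qed.

(* Summing over (a, b) the form at the vector conj(v b) e_a - conj(v a) e_b gives
   twice the form (tr A) |v|^2 - v^* A v, as in Lagrange's identity. *)
Lemma psdker_le_trace I (A : I -> I -> C) : psdker A ->
  psdker (fun a b => (\sum_s A s s) * (a == b)%:R - A a b).
Proof.
move=> Apsd v.
have : 0 <= \sum_a \sum_b (v b * (v b)^* * A a a + v a * (v a)^* * A b b
    - ((v a)^* * A a b * v b + (v b)^* * A b a * v a)).
  apply: sumr_ge0 => a _; apply: sumr_ge0 => b _.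
  have := psdker_pair a b (v b)^* (- (v a)^*) Apsd; congr (0 <= _).
  rewrite rmorphN /= !conjCK; ring.
set Q := \sum_a \sum_b _; suff -> : Q = 2 * \sum_a \sum_b
    (v a)^* * ((\sum_s A s s) * (a == b)%:R - A a b) * v b.
  by rewrite pmulr_rge0 ?ltr0n.
have splitE (F G : I -> I -> C) :
    \sum_a \sum_b (F a b + G a b) = \sum_a \sum_b F a b + \sum_a \sum_b G a b.
  by rewrite -big_split /=; apply: eq_bigr => a _; rewrite -big_split.
have subE (F G : I -> I -> C) :
    \sum_a \sum_b (F a b - G a b) = \sum_a \sum_b F a b - \sum_a \sum_b G a b.
  by rewrite -sumrB /=; apply: eq_bigr => a _; rewrite -sumrB.
rewrite /Q subE splitE splitE.
have -> : \sum_a \sum_b v a * (v a)^* * A b b =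
    \sum_a \sum_b v b * (v b)^* * A a a by rewrite exchange_big.
have -> : \sum_a \sum_b (v b)^* * A b a * v a =
    \sum_a \sum_b (v a)^* * A a b * v b by rewrite exchange_big.
rewrite -!mulr2n -mulrnBl -subE [RHS]mulr_natl; congr (_ *+ 2).
rewrite subE; under [RHS]eq_bigr do under eq_bigr do rewrite mulrBr mulrBl.
rewrite subE; congr (_ - _); rewrite exchange_big; apply: eq_bigr => a _ /=.
rewrite [RHS](bigD1 a) //= [X in _ + X]big1 ?addr0 => [|b]; last first.
  by rewrite eq_sym => /negbTE ->; rewrite !(mulr0, mul0r).
by rewrite eqxx mulr1 -mulr_sumr -mulrA [LHS]mulrC.
Qed.

End PositiveKernels.

(** * Operator bounds on channel outputs, stable under tensoring *)

Section ChannelBounds.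
Variable R : realType.
Local Notation C := R[i].

Local Open Scope sesquilinear_scope.

(** Diagonalize [A] by a unitary [P]: the trace becomes the sum of the eigenvalues of [A] weighted
    by the diagonal entries of P B P^*. *)
Lemma psdmx_trace_mul_ge0 n (A B : 'M[C]_n) :
  psdmx A -> psdmx B -> 0 <= \tr (A *m B).
Proof.
move=> Apsd Bpsd.
have Aherm : A \is hermsymmx.
  apply/is_hermitianmxP; rewrite expr0 scale1r; apply/matrixP => i j.
  by rewrite !mxE; apply: psdker_herm; apply/psdmxP.
have /orthomx_spectralP := hermitian_normalmx Aherm.
set P := spectralmx A; set D := spectral_diag A => EA.
have PU : P \is unitarymx := spectral_unitarymx A.
have ED i : (P *m A *m P ^t*) i i = D 0 i.
  rewrite EA invmx_unitary // !mulmxA (unitarymxP PU) mul1mx -mulmxA.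
  by rewrite (unitarymxP PU) mulmx1 mxE eqxx.
have -> : \tr (A *m B) = \tr (diag_mx D *m (P *m B *m P ^t*)).
  by rewrite EA invmx_unitary // -!mulmxA mxtrace_mulC -!mulmxA.
rewrite mul_diag_mx.
apply: sumr_ge0 => i _; rewrite mxE.
(* The entry is the form of [M] at the adjoint of row [i] of [P]. Taking [M] to be [A] gives the
   eigenvalue, taking [B] the weight. *)
have conjrow (M : 'M[C]_n) : psdmx M -> 0 <= (P *m M *m P ^t*) i i.
  move=> /(_ ((row i P) ^t*)); rewrite trmxCK.
  by rewrite -row_mul !mxE; congr (0 <= _); apply: eq_bigr => j _; rewrite !mxE.
by rewrite mulr_ge0 ?conjrow // -ED conjrow.
Qed.

(* The operator inequality (id_K (x) f)(A) <= b tr(A) I for all positive A and all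
   ancillas K. *)
Definition trace_bounded m n (b : C) (f : {linear 'M[C]_m -> 'M[C]_n}) : Prop :=
  forall (K : finType) (A : K * 'I_m -> K * 'I_m -> C), psdker A ->
  psdker (fun x y : K * 'I_n => b * (\sum_a A a a) * (x == y)%:R -
    f (\matrix_(i, j) A (x.1, i) (y.1, j)) x.2 y.2).

Section Depolarized.
Variables (d : nat) (lambda : R).
Hypotheses (lambda01 : 0 <= lambda <= 1).

Let a : C := lambda%:C%C + (1 - lambda)%:C%C * d%:R^-1.

(** Depolarizing the second factor turns Y into lambda Y + ((1 - lambda)/d) (tr_2 Y) (x) I. The two
    hypotheses bound Y and tr_2 Y by the same [t], and combining them with these weights yields the
    factor [a]. *)
Lemma depolmx_ker_bounded (K : finType) (t : C)
    (Y : K * 'I_d -> K * 'I_d -> C) :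
  psdker (fun x y => t * (x == y)%:R - Y x y) ->
  psdker (fun x y : K => t * (x == y)%:R - \sum_s Y (x, s) (y, s)) ->
  psdker (fun x y : K * 'I_d => a * t * (x == y)%:R -
    depolmx lambda (\matrix_(i, j) Y (x.1, i) (y.1, j)) x.2 y.2).
Proof.
case/andP: lambda01 => l0 l1 H1 /(psdker_tens1 (J := 'I_d)) H2.
have l0' : 0 <= lambda%:C%C by rewrite ler0c.
have l1' : 0 <= (1 - lambda)%:C%C * d%:R^-1 :> C.
  by rewrite mulr_ge0 ?invr_ge0 ?ler0n // ler0c subr_ge0.
apply: eq_psdker (psdkerD (psdkerZ l0' H1) (psdkerZ l1' H2)) => -[x i] [y j].
rewrite /depolmx !mxE /mxtrace /= -pair_eqE /= /a.
have -> : \sum_i0 (\matrix_(i1, j0) Y (x, i1) (y, j0)) i0 i0 =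
    \sum_s Y (x, s) (y, s) by apply: eq_bigr => s _; rewrite mxE.
case: (x == y); case: (i == j) => /=; rewrite ?(mulr1, mulr0, mulr0n); ring.
Qed.

Lemma depolmx_trace_bounded :
  trace_bounded a (depolmx lambda : {linear 'M[C]_d -> 'M[C]_d}).
Proof.
move=> K A Apsd; apply: depolmx_ker_bounded; first exact: psdker_le_trace.
have := psdker_le_trace (psdker_ptrace Apsd); apply: eq_psdker => x y.
by congr (_ * _ - _); rewrite pair_big; apply: eq_bigr => -[].
Qed.

(** Apply [g] first, treating the factor to be depolarized as part of the ancilla;
    [depolmx_ker_bounded] then handles that factor. *)
Lemma tensmap_depolmx_trace_bounded m n (b : C)
    (g : {linear 'M[C]_m -> 'M[C]_n}) : trace_bounded b g ->
  trace_bounded (a * b)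
    (tensmap (depolmx lambda : {linear 'M[C]_d -> 'M[C]_d}) g).
Proof.
move=> gb K A Apsd.
pose h (x : (K * 'I_d) * 'I_m) := (x.1.1, mxtens_index (x.1.2, x.2)).
pose B := fun x y => A (h x) (h y).
have Bpsd : psdker B by exact: psdker_comp.
have trB : \sum_x B x x = \sum_x A x x.
  rewrite [RHS](reindex h) //=; apply: onW_bij.
  exists (fun b : K * 'I_(d * m) =>
      ((b.1, (mxtens_unindex b.2).1), (mxtens_unindex b.2).2)).
    by move=> [[x i] u]; rewrite /h [X in mxtens_unindex X]/= mxtens_indexK.
  by move=> [x c]; case: (mxtens_indexP c) => i u; rewrite mxtens_indexK.
pose t := b * \sum_x A x x.
(* The output of [g] under the ancilla K x d, with the d-dimensional factor moved last. *)
pose Y (x y : (K * 'I_n) * 'I_d) :=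
  g (\matrix_(u, w) B ((x.1.1, x.2), u) ((y.1.1, y.2), w)) x.1.2 y.1.2.
have H1 : psdker (fun x y => t * (x == y)%:R - Y x y).
  pose sw (x : (K * 'I_n) * 'I_d) : (K * 'I_d) * 'I_n := ((x.1.1, x.2), x.1.2).
  have := psdker_comp sw (gb _ _ Bpsd).
  apply: eq_psdker => -[[x i] u] [[y j] w] /=.
  rewrite trB /Y /=; congr (_ * _%:R - _).
  by rewrite -!pair_eqE /= -!pair_eqE /= andbAC.
(* By linearity [g] commutes with tracing out the d-dimensional factor, so its bound with ancilla
   [K] applies to the reduced kernel, whose trace is unchanged. *)
have H2 : psdker (fun x y : K * 'I_n =>
    t * (x == y)%:R - \sum_s Y (x, s) (y, s)).
  pose sw (x : (K * 'I_m) * 'I_d) : (K * 'I_d) * 'I_m := ((x.1.1, x.2), x.1.2).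
  have := gb _ _ (psdker_ptrace (psdker_comp sw Bpsd)).
  apply: eq_psdker => x y; congr (_ * _ * _ - _).
    rewrite -trB pair_big [RHS](reindex sw) /=; last first.
      by apply: onW_bij; exists (fun x => ((x.1.1, x.2), x.1.2)) => -[[]].
    by apply: eq_bigr => -[].
  rewrite /Y /= -summxE -linear_sum /=; congr (g _ _ _).
  by apply/matrixP => u w; rewrite summxE mxE; apply: eq_bigr => s _; rewrite mxE.
pose h2 (x : K * 'I_(d * n)) : (K * 'I_n) * 'I_d :=
  ((x.1, (mxtens_unindex x.2).2), (mxtens_unindex x.2).1).
have := psdker_comp h2 (depolmx_ker_bounded H1 H2).
apply: eq_psdker => -[x c] [y e].
case: (mxtens_indexP c) => i u; case: (mxtens_indexP e) => j w.
have E x1 (y1 : 'I_d) z : h2 (x1, mxtens_index (y1, z)) = ((x1, z), y1).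
  by rewrite /h2 mxtens_indexK.
rewrite !E tensmapE /t mulrA; congr (_ * _%:R - _).
  have /inj_eq <- : injective h2.
    move=> [x1 c1] [y1 e1].
    case: (mxtens_indexP c1) => i1 u1; case: (mxtens_indexP e1) => j1 w1.
    by rewrite !E => -[-> -> ->].
  by rewrite !E.
rewrite /=; congr (depolmx _ _ _ _).
apply/matrixP => s s'; rewrite !mxE /Y /=; congr (g _ _ _).
by apply/matrixP => y1 z; rewrite !mxE.
Qed.
End Depolarized.
End ChannelBounds.

(** * Upper and lower bounds on the communication value *)

Section CvBounds.
Variable R : realType.
Local Notation C := R[i].

Lemma Re_sum (I : Type) (r : seq I) (P : pred I) (F : I -> C) :
  complex.Re (\sum_(i <- r | P i) F i) = \sum_(i <- r | P i) complex.Re (F i).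
Proof. by apply: (big_morph (@complex.Re R)) => // -[? ?] [? ?]. Qed.

Lemma psdmx_trace_ge0 n (A : 'M[C]_n) : psdmx A -> 0 <= \tr A.
Proof.
by move=> /psdmxP Apsd; apply: sumr_ge0 => i _; exact: psdker_diag_ge0 Apsd.
Qed.

Lemma trace_bounded_density m n (b : C) (f : {linear 'M[C]_m -> 'M[C]_n})
    (rho : 'M[C]_m) : trace_bounded b f -> density rho ->
  psdmx (b%:M - f rho).
Proof.
move=> fb [/psdmxP rho_psd tr_rho]; apply/psdmxP.
have := fb _ _ (psdker_comp (fun a : unit * 'I_m => a.2) rho_psd).
move=> /(psdker_comp (fun i : 'I_n => (tt, i) : (unit * 'I_n)%type)).
apply: eq_psdker => i j; rewrite !mxE /= (_ : \matrix_(s, t) rho s t = rho).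
  congr (_ - _); rewrite -[RHS]mulr_natr; congr (_ * _%:R).
  rewrite -[RHS]mulr1 -tr_rho /mxtrace; congr (_ * _).
  rewrite (reindex (fun i : 'I_m => (tt, i) : (unit * 'I_m)%type)) //=.
  by exists snd => // -[[]].
by apply/matrixP => s t; rewrite mxE.
Qed.

(** Every input satisfies Tr(Pi_y N(rho_x)) <= beta Tr(Pi_y), a bound independent of x, and the
    traces of the POVM elements add up to [n]. *)
Lemma cv_values_ubound m n (N : channel R m n) (beta : R) :
  0 <= beta -> trace_bounded beta%:C%C N -> ubound (cv_values N) (beta * n%:R).
Proof.
move=> beta0 Nb _ [k [k' [rho [Pi [_ rhoD [Pi_psd Pi_sum] ->]]]]].
have -> : beta * n%:R = \sum_(y < k') beta * complex.Re (\tr (Pi y)).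
  rewrite -mulr_sumr; congr (_ * _).
  rewrite -Re_sum -linear_sum /= Pi_sum mxtrace1.
  by rewrite -(rmorph_nat (real_complex R)).
(* The default 0 of the maximum must also lie below beta Tr(Pi_y). *)
apply: ler_sum => y _; elim/big_rec: _ => [|x z _ zle].
  rewrite mulr_ge0 //.
  by have := psdmx_trace_ge0 (Pi_psd y); rewrite lecE => /andP[].
rewrite ge_max zle andbT /transition.
have := psdmx_trace_mul_ge0 (Pi_psd y) (trace_bounded_density Nb (rhoD x)).
rewrite mulmxBr mul_mx_scalar linearB /= mxtraceZ subr_ge0 lecE => /andP[_].
by case: (\tr (Pi y)) => p q /=; rewrite mul0r subr0.
Qed.

(** For a channel, the total probability of correct transmission when basis states are sent and
    measured in the same basis. It is multiplicative under tensor products. *)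
Definition diag_weight n (f : {linear 'M[C]_n -> 'M[C]_n}) : C :=
  \sum_y f (delta_mx y y) y y.

Lemma psdmx_delta n (i : 'I_n) : psdmx (delta_mx i i : 'M[C]_n).
Proof.
apply/psdmxP => v; rewrite (bigD1 i) //= [X in _ + X]big1 ?addr0 => [|a /negbTE ai].
  rewrite (bigD1 i) //= big1 ?addr0 => [|b /negbTE bi].
    by rewrite mxE !eqxx mulr1 mulrC mul_conjC_ge0.
  by rewrite mxE bi andbF mulr0 mul0r.
by rewrite big1 // => b _; rewrite mxE ai mulr0 mul0r.
Qed.

Lemma cv_values_diag_weight n (N : channel R n n) : (0 < n)%N ->
  exists2 c, cv_values N c & complex.Re (diag_weight N) <= c.
Proof.
move=> n0; pose E (x : 'I_n) : 'M[C]_n := delta_mx x x.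
exists (classical_cv (transition N E E)).
  exists n, n, E, E; split=> // [x|]; first split.
  - exact: psdmx_delta.
  - by rewrite mxtrace_delta eqxx.
  - split=> [y|]; first exact: psdmx_delta.
    by rewrite mx1_sum_delta.
rewrite /diag_weight Re_sum; apply: ler_sum => y _.
(* The maximum over inputs is at least its term x = y. *)
rewrite (bigD1 y) //= le_max; apply/orP; left.
rewrite /transition /E /mxtrace (bigD1 y) //= big1 ?addr0 => [|i iy].
  rewrite -(mul_delta_mx (0 : 'I_1)) -mulmxA -rowE mxE big_ord1 !mxE !eqxx.
  by rewrite mul1r.
by rewrite -(mul_delta_mx (0 : 'I_1)) -mulmxA mxE big_ord1 mxE (negbTE iy) mul0r.
Qed.

Lemma delta_mx_tens m n (i : 'I_m) (k : 'I_n) :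
  delta_mx (mxtens_index (i, k)) (mxtens_index (i, k)) =
  delta_mx i i *t delta_mx k k :> 'M[C]_(m * n).
Proof.
have mx_inj := bij_inj (mxtens_index_bij m n).
apply/matrixP => a b.
case: (mxtens_indexP a) => i1 k1; case: (mxtens_indexP b) => i2 k2.
rewrite tensmxE !mxE !(inj_eq mx_inj) -!pair_eqE /= -natrM mulnb.
by rewrite andbACA.
Qed.

Lemma diag_weight_tensmap m n (f : {linear 'M[C]_m -> 'M[C]_m})
    (g : {linear 'M[C]_n -> 'M[C]_n}) :
  diag_weight (tensmap f g) = diag_weight f * diag_weight g.
Proof.
rewrite /diag_weight sum_mxtens mulr_suml; apply: eq_bigr => i _.
rewrite mulr_sumr; apply: eq_bigr => k _.
by rewrite delta_mx_tens /= tensmap_tens tensmxE.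
Qed.

Section Depolarizing.
Variables (d : nat) (lambda : R).
Hypotheses (d_gt0 : (0 < d)%N) (lambda01 : 0 <= lambda <= 1).

Let c := lambda * d%:R + (1 - lambda).
Let D := depolarizing d_gt0 lambda01.

Lemma depol_cv_ge1 : 1 <= c.
Proof.
have [l0 l1] := andP lambda01.
have d1 : 1 <= d%:R :> R by rewrite ler1n.
have := mulr_ge0 l0 (_ : 0 <= d%:R - 1); rewrite subr_ge0 /c => /(_ d1); lra.
Qed.

Lemma diag_weight_depolmx :
  diag_weight (depolmx lambda : {linear 'M[C]_d -> 'M[C]_d}) = c%:C%C.
Proof.
have d0 : d%:R != 0 :> C by rewrite pnatr_eq0 -lt0n.
rewrite /diag_weight (eq_bigr (fun=> lambda%:C%C + (1 - lambda)%:C%C * d%:R^-1)).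
  rewrite sumr_const card_ord -[LHS]mulr_natr mulrDl mulfVK //.
  by rewrite /c [RHS]rmorphD /= rmorphM /= rmorph_nat.
by move=> y _; rewrite !mxE mxtrace_delta !eqxx !mulr1.
Qed.

(** The index is shifted: [channel_pow_rec D k] consists of k + 1 copies. The operator bound and the
    basis strategy meet because a d = c. *)
Lemma cv_depolarizing_pow k : cv (channel_pow_rec D k) = c ^+ k.+1.
Proof.
pose a := lambda + (1 - lambda) / d%:R.
have d0 : d%:R != 0 :> R by rewrite pnatr_eq0 -lt0n.
have ad : a * d%:R = c by rewrite /a mulrDl mulfVK.
have a0 : 0 <= a.
  have [l0 l1] := andP lambda01.
  by rewrite addr_ge0 // divr_ge0 ?ler0n // subr_ge0.
have aC : a%:C%C = lambda%:C%C + (1 - lambda)%:C%C * d%:R^-1.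
  by rewrite /a [LHS]rmorphD /= rmorphM /= fmorphV /= rmorph_nat.
have bounded : trace_bounded (a ^+ k.+1)%:C%C (channel_pow_rec D k).
  elim: k => [|k IH]; first by rewrite expr1 aC; exact: depolmx_trace_bounded.
  by rewrite exprS rmorphM /= aC; exact: tensmap_depolmx_trace_bounded.
have weight : diag_weight (channel_pow_rec D k) = (c ^+ k.+1)%:C%C.
  elim: k {bounded} => [|k IH]; first by rewrite expr1 diag_weight_depolmx.
  by rewrite /= diag_weight_tensmap IH diag_weight_depolmx [in RHS]exprS rmorphM.
have ub : ubound (cv_values (channel_pow_rec D k)) (c ^+ k.+1).
  rewrite -ad exprMn -natrX.
  exact: cv_values_ubound (exprn_ge0 _ a0) bounded.
have [|v vin] := cv_values_diag_weight (channel_pow_rec D k).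
  by rewrite expn_gt0 d_gt0.
rewrite weight /= => le_v; apply/eqP; rewrite eq_le /cv; apply/andP; split.
  by apply: ge_sup => //; exists v.
by apply: le_trans le_v _; apply: ub_le_sup => //; exists (c ^+ k.+1).
Qed.

End Depolarizing.
End CvBounds.

Theorem mainTheorem11 (R : realType) (d : nat) (lambda : R)
    (d_gt0 : (0 < d)%N) (lambda01 : 0 <= lambda <= 1) :
  let D := depolarizing d_gt0 lambda01 in
  [/\ cv D = lambda * d%:R + (1 - lambda),
      cvgn (cv_rate D) &
      cv_capacity D = log2 (cv D)].
Proof.
move=> D.
have cvD : cv D = lambda * d%:R + (1 - lambda).
  by rewrite -[RHS]expr1 -(cv_depolarizing_pow d_gt0 lambda01 0).
have rate : cv_rate D @ \oo --> log2 (cv D).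
  (* The rate is constant from k = 1 on; the conventional value at k = 0 is discarded. *)
  apply: cvg_near_cst; exists 1%N => // -[//|k] _ /=.
  have c_gt0 : 0 < lambda * d%:R + (1 - lambda).
    exact: lt_le_trans ltr01 (depol_cv_ge1 d_gt0 lambda01).
  rewrite /cv_rate /= cv_depolarizing_pow cvD /log2 lnXn // mulrnAl.
  by rewrite -[X in _ * X]mulr_natl mulKf // pnatr_eq0.
split=> //; first by apply/cvg_ex; exists (log2 (cv D)).
exact: cvg_lim rate.
Qed.
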